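(* Let $d\in\mathbb{N}$ and let $\{X_{\mathbf n}:\mathbf n\in\mathbb{Z}^d\}$ be a stationary real-valued random field. Then $\{X_{\mathbf n}\}$ admits a continuous phantom distribution function if and only if there exist $\gamma\in(0,1)$ and a strongly monotone field of levels $\{v_{\mathbf n}:\mathbf n\in\mathbb{N}^d\}\subset\mathbb{R}$ such that the following two conditions hold: (i) $P(M_{\mathbf n}\le v_{\mathbf n})\to\gamma$ as $\mathbf n\to\boldsymbol\infty$ (coordinatewise); (ii) for every monotone curve $\boldsymbol\psi$ in $\mathbb{N}^d$ and every $T>0$, $\beta_T^{\boldsymbol\psi}(n)\to0$ as $n\to\infty$, where $$\beta^{\boldsymbol\psi}_T(n)=\max_{\mathbf p(1)+\mathbf p(2)\le T\boldsymbol\psi(n)}\Big|P\big(M_{\mathbf p(1)+\mathbf p(2)}\le v_{\boldsymbol\psi(n)}\big)-\prod_{\mathbf i\in\{1,2\}^d}P\big(M_{(p_1(i_1),p_2(i_2),\ldots,p_d(i_d))}\le v_{\boldsymbol\psi(n)}\big)\Big|,$$ the maximum being over $\mathbf p(1),\mathbf p(2)\in\mathbb{N}_0^d$ with $\mathbf p(1)+\mathbf p(2)\le T\boldsymbol\psi(n)$.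
   Context: $\mathbb{N}=\{1,2,\ldots\}$, $\mathbb{N}_0=\mathbb{N}\cup\{0\}$; $\le$ on vectors is the coordinatewise partial order; $\mathbf 1=(1,\ldots,1)$. A random field is stationary if its finite-dimensional distributions are invariant under translations of $\mathbb{Z}^d$. For $\mathbf n\in\mathbb{Z}^d$, $M_{\mathbf n}=\max\{X_{\mathbf k}:\mathbf 1\le\mathbf k\le\mathbf n\}$ if $\mathbf 1\le\mathbf n$, and $M_{\mathbf n}=-\infty$ otherwise (so $P(M_{\mathbf n}\le v)=1$ if some coordinate of $\mathbf n$ is $0$). $\mathbf n^*=n_1n_2\cdots n_d$. $\mathbf n\to\boldsymbol\infty$ means that every coordinate tends to infinity. A distribution function $G$ is a phantom distribution function for $\{X_{\mathbf n}\}$ if $\sup_{x\in\mathbb{R}}|P(M_{\mathbf n}\le x)-G(x)^{\mathbf n^*}|\to0$ as $\mathbf n\to\boldsymbol\infty$. A field of levels $v_{(\cdot)}:\mathbb{N}^d\to\mathbb{R}$ is strongly monotone if $v_{\mathbf m}\le v_{\mathbf n}$ whenever $\mathbf m^*\le\mathbf n^*$. A monotone curve in $\mathbb{N}^d$ is a map $\boldsymbol\psi:\mathbb{N}\to\mathbb{N}^d$ such that $\boldsymbol\psi(n)\to\boldsymbol\infty$, $\boldsymbol\psi(n)\le\boldsymbol\psi(n+1)$ and $\boldsymbol\psi(n)\ne\boldsymbol\psi(n+1)$ for all $n$, and $\boldsymbol\psi(n)^*/\boldsymbol\psi(n+1)^*\to1$ as $n\to\infty$. *)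

(* Defs.v *)
From HB Require Import structures.
From mathcomp Require Import all_boot all_order all_algebra.
From mathcomp Require Import all_classical all_reals all_analysis.

Set Implicit Arguments.
Unset Strict Implicit.
Unset Printing Implicit Defensive.

Import Order.TTheory GRing.Theory Num.Theory.
Import numFieldNormedType.Exports.

Local Open Scope classical_set_scope.
Local Open Scope ring_scope.

(* [natvec d] is N_0^d; elements of N^d, N = {1, 2, ...}, are the vectors
   satisfying [vpos]. *)
Notation natvec d := {ffun 'I_d -> nat}.
Notation intvec d := {ffun 'I_d -> int}.

Definition vpos d (n : natvec d) : Prop := forall i, (0 < n i)%N.

Definition vle d (m n : natvec d) : Prop := forall i, (m i <= n i)%N.

Definition vprod d (n : natvec d) : nat := (\prod_(i < d) n i)%N.

(* The filter of "every coordinate tends to infinity". *)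
Definition vinfty d : set_system (natvec d) :=
  filter_from [set: natvec d] (fun N => [set n | vle N n]).

Arguments vinfty d : clear implicits.

Global Instance vinfty_filter d : ProperFilter (vinfty d).
Proof.
apply: filter_from_proper; last by move=> N _; exists N => i.
apply: filter_from_filter; first by exists [ffun=> 0%N].
move=> M N _ _; exists [ffun i => maxn (M i) (N i)] => // n Hn.
by split=> i; have := Hn i; rewrite ffunE geq_max => /andP[].
Qed.

Section random_field.
Context dO (Omega : measurableType dO) (R : realType) (P : probability Omega R).
Context (d : nat) (X : intvec d -> {RV P >-> R}).

Definition joint (k : nat) (t : 'I_k -> intvec d) (w : Omega) : k.-tuple R :=
  [tuple X (t j) w | j < k].

Definition stationary : Prop :=
  forall (h : intvec d) (k : nat) (t : 'I_k -> intvec d) (B : set (k.-tuple R)),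
    measurable B ->
    P (joint (fun j => t j + h) @^-1` B) = P (joint t @^-1` B).

(* M_n. The index j ranges over prod_i {0, ..., n_i - 1}, so that j + 1 ranges
   over the box {k | 1 <= k <= n}; if some n_i = 0 the range is empty and the
   value is -oo. *)
Definition fmax (n : natvec d) (w : Omega) : \bar R :=
  \big[maxe/-oo%E]_(j : {dffun forall i : 'I_d, 'I_(n i)})
    (X [ffun i => Posz (j i).+1] w)%:E.

Definition Pmax (n : natvec d) (x : R) : R :=
  fine (P [set w | (fmax n w <= x%:E)%E]).

Definition phantom (G : R -> R) : Prop :=
  sup (range (fun x => `|Pmax n x - G x ^+ vprod n|)) @[n --> vinfty d]
    --> (0 : R).

(* [cumulativeBounded 0 1] is the type of distribution functions on R. *)
Definition has_continuous_phantom : Prop :=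
  exists G : cumulativeBounded (0 : R) (1 : R), continuous G /\ phantom G.

(* A field of levels indexed by N^d is a function on [natvec d] whose values
   outside [vpos] are irrelevant. *)
Definition strongly_monotone (v : natvec d -> R) : Prop :=
  forall m n, vpos m -> vpos n -> (vprod m <= vprod n)%N -> v m <= v n.

(* The parameter of the curve starts at 0 instead of 1. *)
Definition monotone_curve (psi : nat -> natvec d) : Prop :=
  [/\ forall n, vpos (psi n),
      psi n @[n --> \oo] --> vinfty d,
      forall n, vle (psi n) (psi n.+1),
      forall n, psi n <> psi n.+1
    & (vprod (psi n))%:R / (vprod (psi n.+1))%:R @[n --> \oo] --> (1 : R)].

(* (p_1(i_1), ..., p_d(i_d)), with [false] for 1 and [true] for 2. *)
Definition mix (p1 p2 : natvec d) (i : {ffun 'I_d -> bool}) : natvec d :=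
  [ffun j => if i j then p2 j else p1 j].

Definition mixing_gap (x : R) (p1 p2 : natvec d) : R :=
  `|Pmax (p1 + p2) x - \prod_(i : {ffun 'I_d -> bool}) Pmax (mix p1 p2 i) x|.

(* The set below is finite, and nonempty when T > 0 (take p1 = p2 = 0), so the
   supremum is the maximum. *)
Definition beta (v : natvec d -> R) (psi : nat -> natvec d) (T : R) (n : nat) : R :=
  sup [set mixing_gap (v (psi n)) p.1 p.2 | p in
    [set p : natvec d * natvec d |
      forall i, (p.1 i + p.2 i)%:R <= T * (psi n i)%:R]].

End random_field.

(* Main.v *)
Require Import Defs.
From HB Require Import structures.
From mathcomp Require Import all_boot all_order all_algebra.
From mathcomp Require Import all_classical all_reals all_analysis.
From mathcomp Require Import lra.
Import Order.TTheory GRing.Theory Num.Theory.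
Import numFieldNormedType.Exports.

Local Open Scope classical_set_scope.
Local Open Scope ring_scope.

(* A continuous phantom G yields levels through G(v_n)^(n* ) = gamma.

   Conversely, only the splitting of a box along a single coordinate is needed.
   Since a monotone curve can be drawn through any sequence of points that tends
   to infinity, condition (ii) holds uniformly as n tends to infinity. It then
   says that, at level v_q, the probability P(M <= v_q) is almost multiplicative
   in the length of one side of the box, hence almost geometric in it. Comparing
   a box n with a box q that differs from n in that side only, and whose volume
   is n* / t up to rounding, gives P(M_n <= v_q) -> gamma^t. As v_q depends on q*
   only, this determines P(M_n <= x) up to o(1) for all x, and G is obtained by
   inverting the levels, viewed as a function of gamma^(1 / q* ). *)

Set Implicit Arguments.
Unset Strict Implicit.
Unset Printing Implicit Defensive.

(** * Distribution functions of partial maxima *)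

Section partial_maxima.
Context (dO : measure_display) (Omega : measurableType dO) (R : realType).
Context (P : probability Omega R) (d : nat) (X : intvec d -> {RV P >-> R}).
Implicit Types (m n p q : natvec d) (x y : R).

Lemma fmax_le n x w :
  (fmax X n w <= x%:E)%E <->
  forall j : {dffun forall i : 'I_d, 'I_(n i)},
    X [ffun i => Posz (j i).+1] w <= x.
Proof.
split=> [/bigmax_leP[_ H] j|H]; first by rewrite -lee_fin; exact: H.
by apply/bigmax_leP; split=> [|j _]; rewrite ?leNye // lee_fin.
Qed.

Lemma measurable_fmax_le n x : measurable [set w | (fmax X n w <= x%:E)%E].
Proof.
have -> : [set w | (fmax X n w <= x%:E)%E] =
    \bigcap_(j in [set: {dffun forall i : 'I_d, 'I_(n i)}])
      (X [ffun i => Posz (j i).+1] @^-1` [set` `]-oo, x]]).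
  apply/seteqP; split=> w /=.
    by move/fmax_le => H j _ /=; rewrite in_itv /=.
  move=> H; apply/fmax_le => j; have := H j I.
  by rewrite /= in_itv.
apply: fin_bigcap_measurable => [|j _]; first exact: finite_finset.
by apply: measurable_funPTI; exact: measurable_itv.
Qed.

Lemma Pmax_ge0 n x : 0 <= Pmax X n x.
Proof. exact/fine_ge0/measure_ge0. Qed.

Lemma Pmax_le1 n x : Pmax X n x <= 1.
Proof.
rewrite -[1]/(fine 1%:E) fine_le ?fin_num_measure ?probability_le1 //;
  exact: measurable_fmax_le.
Qed.

Lemma Pmax_le m n x y : vle n m -> x <= y -> Pmax X m x <= Pmax X n y.
Proof.
move=> nm xy; have mM := measurable_fmax_le.
rewrite /Pmax fine_le ?fin_num_measure ?le_measure ?inE //.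
move=> w /= /fmax_le H; apply/fmax_le => j.
have := H [ffun i => widen_ord (nm i) (j i)].
move=> /le_trans => /(_ _ xy); congr (X _ w <= y).
by apply/ffunP => i; rewrite !ffunE.
Qed.

Lemma Pmax_eq1 n i x : n i = 0%N -> Pmax X n x = 1.
Proof.
move=> ni0; rewrite /Pmax.
have -> : [set w | (fmax X n w <= x%:E)%E] = setT.
  apply/seteqP; split=> w //= _; apply/fmax_le => j.
  by have := leq_ltn_trans (leq0n _) (ltn_ord (j i)); rewrite ni0.
by rewrite probability_setT.
Qed.

End partial_maxima.

(** * Boxes with one side replaced *)

Definition vset d (n : natvec d) (i : 'I_d) (a : nat) : natvec d :=
  [ffun j => if j == i then a else n j].

Section vectors.
Context (d : nat).
Implicit Types (m n : natvec d) (i : 'I_d).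

Lemma vset_eq n i a : vset n i a i = a.
Proof. by rewrite ffunE eqxx. Qed.

Lemma vset_vset n i a b : vset (vset n i a) i b = vset n i b.
Proof. by apply/ffunP => j; rewrite !ffunE; case: eqP. Qed.

Lemma vset_id n i : vset n i (n i) = n.
Proof. by apply/ffunP => j; rewrite !ffunE; case: eqP => // ->. Qed.

Lemma vle_vset n i a b : (a <= b)%N -> vle (vset n i a) (vset n i b).
Proof. by move=> ab j; rewrite !ffunE; case: eqP. Qed.

(** The factor [vprod (vset n i 1)] is the volume of the face orthogonal to direction [i]. *)
Lemma vprod_vset n i a : vprod (vset n i a) = (a * vprod (vset n i 1))%N.
Proof.
rewrite /vprod (bigD1 i) //= [in RHS](bigD1 i) //= !ffunE eqxx mul1n.
by congr (_ * _)%N; apply: eq_bigr => j /negPf ji; rewrite !ffunE ji.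
Qed.

Lemma vprod_gt0 n : vpos n -> (0 < vprod n)%N.
Proof. by move=> n0; apply: prodn_gt0. Qed.

Lemma leq_vprod m n : vle m n -> (vprod m <= vprod n)%N.
Proof. by move=> mn; apply: leq_prod => i _; exact: mn. Qed.

Lemma vinfty_ge N : \forall n \near vinfty d, vle N n.
Proof. by exists N. Qed.

Lemma vinfty_coord i K : \forall n \near vinfty d, (K <= (n : natvec d) i)%N.
Proof. by exists [ffun=> K] => // n /= /(_ i); rewrite ffunE. Qed.

Lemma vinfty_pos : \forall n \near vinfty d, vpos n.
Proof. by exists [ffun=> 1%N] => // n /= H i; have := H i; rewrite ffunE. Qed.

Lemma leq_coord_vprod n i : vpos n -> (n i <= vprod n)%N.
Proof.
move=> n0; rewrite -[in leqRHS](vset_id n i) vprod_vset leq_pmulr //.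
by apply: vprod_gt0 => j; rewrite ffunE; case: eqP.
Qed.

End vectors.

(** * Mixing gaps and mixed boxes *)

Section gaps.
Context (dO : measure_display) (Omega : measurableType dO) (R : realType).
Context (P : probability Omega R) (d : nat) (X : intvec d -> {RV P >-> R}).
Implicit Types (m n p q : natvec d) (x y : R).

Lemma mixing_gap_le1 x p1 p2 : mixing_gap X x p1 p2 <= 1.
Proof.
rewrite /mixing_gap; set a := Pmax _ _ _; set b := \prod_i _.
have a0 : 0 <= a := Pmax_ge0 _ _ _; have a1 : a <= 1 := Pmax_le1 _ _ _.
have /andP[b0 b1] : 0 <= b <= 1.
  rewrite /b; elim/big_ind: _ => [|u v /andP[u0 u1] /andP[v0 v1]|i _].
  - by rewrite ler01 lexx.
  - by rewrite mulr_ge0 ?mulr_ile1.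
  - by rewrite Pmax_ge0 Pmax_le1.
by rewrite ler_norml; lra.
Qed.

(** When the second vector is supported on direction [i], all but two of the mixed boxes have a side
    0 and contribute a factor 1. This extracts from condition (ii) the splitting along one side. *)
Lemma mixing_gap_vset x n i a b :
  mixing_gap X x (vset n i a) [ffun j => if j == i then b else 0%N] =
  `|Pmax X (vset n i (a + b)) x - Pmax X (vset n i a) x * Pmax X (vset n i b) x|.
Proof.
rewrite /mixing_gap; congr (`|Pmax X _ x - _|).
  by apply/ffunP => j; rewrite !ffunE; case: eqP => // _; rewrite addr0.
rewrite (bigD1 [ffun=> false]) //= (bigD1 [ffun j => j == i]) /=; last first.
  by apply/eqP => /ffunP /(_ i); rewrite !ffunE eqxx.
rewrite big1 ?mulr1.
  congr (Pmax X _ x * Pmax X _ x); apply/ffunP => j; rewrite !ffunE //.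
  by case: eqP.
move=> f /andP[/eqP f0 /eqP fi].
have [/existsP[j /andP[ji fj]]|/existsPn H] := boolP [exists j, (j != i) && f j].
  by apply: (@Pmax_eq1 _ _ _ _ _ _ _ j); rewrite !ffunE fj (negPf ji).
exfalso; case fii : (f i).
  apply: fi; apply/ffunP => j; rewrite ffunE; case: (eqVneq j i) => [->//|ji].
  by have := H j; rewrite ji /= => /negPf.
apply: f0; apply/ffunP => j; rewrite ffunE; case: (eqVneq j i) => [->//|ji].
by have := H j; rewrite ji /= => /negPf.
Qed.

(** Expanding the product of the sums of sides gives one mixed box per choice function. Hence powers
    [G x ^+ vprod p] factor exactly over the mixed boxes. *)
Lemma vprodD (p1 p2 : natvec d) :
  vprod (p1 + p2) = (\sum_(i : {ffun 'I_d -> bool}) vprod (mix p1 p2 i))%N.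
Proof.
transitivity (\prod_(j < d) \sum_(b : bool) (if b then p2 j else p1 j))%N.
  by apply: eq_bigr => j _; rewrite ffunE big_bool /= addnC.
rewrite bigA_distr_bigA; apply: eq_bigr => f _; apply: eq_bigr => j _.
by rewrite ffunE.
Qed.

End gaps.

(** * Powers of a distribution function and distances of products *)

Section distribution_functions.
Context (R : realType) (G : cumulativeBounded (0 : R) (1 : R)).

Let G_nd : {homo G : x y / x <= y}.
Proof. exact: cumulative_is_nondecreasing. Qed.

Lemma cdf_ge0 x : 0 <= G x.
Proof.
apply: (cvgr_to_le (cumulativeNy G)).
by near do apply: G_nd; exact: nbhs_ninfty_le.
Unshelve. all: by end_near. Qed.

Lemma cdf_le1 x : G x <= 1.
Proof.
apply: (cvgr_to_ge (cumulativey G)).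
by near do apply: G_nd; exact: nbhs_pinfty_ge.
Unshelve. all: by end_near. Qed.

Lemma cdf_exp_onto (c : R) n : continuous G -> 0 < c < 1 -> (0 < n)%N ->
  exists x, G x ^+ n = c.
Proof.
move=> cG /andP[c0 c1] n0; set g := c `^ n%:R^-1.
have gn : g ^+ n = c.
  by rewrite -powR_mulrn ?powR_ge0// -powRrM mulVf ?powRr1 ?ltW// pnatr_eq0 -lt0n.
have g0 : 0 < g by exact: powR_gt0.
have g1 : g < 1.
  by rewrite ltNge; apply/negP => /(exprn_ege1 n); rewrite gn leNgt c1.
have [a Ga] := filter_ex (cvgr_lt _ (cumulativeNy G) _ g0).
have [b Gb] := filter_ex (cvgr_gt _ (cumulativey G) _ g1).
have ab : a <= b.
  rewrite leNgt; apply/negP => /ltW/G_nd Gba.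
  by have := lt_trans (lt_le_trans Gb Gba) Ga; rewrite ltxx.
have [|x _ Gx] := IVT ab (continuous_subspaceT cG) (v := g); last first.
- by exists x; rewrite Gx.
- by rewrite ge_min le_max (ltW Ga) (ltW Gb) orbT.
Qed.

End distribution_functions.

(** The factors are exchanged one at a time; the others lie in [0, 1] and do not enlarge the
    error. *)
Lemma ler_dist_prod (R : realDomainType) (I : Type) (r : seq I) (a b : I -> R) :
  (forall i, 0 <= a i <= 1) -> (forall i, 0 <= b i <= 1) ->
  `|\prod_(i <- r) a i - \prod_(i <- r) b i| <= \sum_(i <- r) `|a i - b i|.
Proof.
move=> a01 b01; elim: r => [|i r IH]; first by rewrite !big_nil subrr normr0.
rewrite !big_cons; set A := \prod_(j <- r) a j; set B := \prod_(j <- r) b j.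
have /andP[B0 B1] : 0 <= B <= 1.
  rewrite /B; elim/big_ind: _ => [|u v /andP[u0 u1] /andP[v0 v1]|j _].
  - by rewrite ler01 lexx.
  - by rewrite mulr_ge0 ?mulr_ile1.
  - exact: b01.
have /andP[ai0 ai1] := a01 i.
have -> : a i * A - b i * B = (a i - b i) * B + a i * (A - B).
  by rewrite mulrBl mulrBr; lra.
apply: (le_trans (ler_normD _ _)); rewrite !normrM addrC (ger0_norm ai0).
rewrite (ger0_norm B0) addrC lerD//; first exact: ler_piMr.
by apply: (le_trans _ IH); exact: ler_piMl.
Qed.

(** * From a continuous phantom distribution function to levels *)

Section phantom_to_levels.
Context (dO : measure_display) (Omega : measurableType dO) (R : realType).
Context (P : probability Omega R) (d : nat) (X : intvec d -> {RV P >-> R}).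
Implicit Types (m n p q : natvec d).

Let phantom_dist_le1 (G : R -> R) n x : 0 <= G x <= 1 ->
  `|Pmax X n x - G x ^+ vprod n| <= 1.
Proof.
move=> /andP[g0 g1]; have a0 := Pmax_ge0 X n x; have a1 := Pmax_le1 X n x.
have b0 : 0 <= G x ^+ vprod n by exact: exprn_ge0.
have b1 : G x ^+ vprod n <= 1 by exact: exprn_ile1.
by rewrite ler_norml; lra.
Qed.

(** The differences form a nonempty set bounded by 1, so [sup] is a true supremum rather than its
    default value. *)
Lemma phantomP (G : R -> R) : (forall x, 0 <= G x <= 1) ->
  Defs.phantom X G <-> forall e, 0 < e -> \forall n \near vinfty d,
    forall x, `|Pmax X n x - G x ^+ vprod n| <= e.
Proof.
move=> G01.
have ub n : has_ubound (range (fun x => `|Pmax X n x - G x ^+ vprod n|)).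
  by exists 1 => _ [x _ <-]; exact: phantom_dist_le1.
split=> [/cvgrPdist_le H e e0|H].
  near=> n => x.
  have : `|0 - sup (range (fun x => `|Pmax X n x - G x ^+ vprod n|))| <= e.
    by near: n; exact: H.
  rewrite sub0r normrN; apply: le_trans; apply: le_trans (ler_norm _).
  by apply: ub_le_sup => //; exists x.
apply/cvgrPdist_le => e e0; near=> n.
have He : forall x, `|Pmax X n x - G x ^+ vprod n| <= e by near: n; exact: H.
rewrite sub0r normrN ger0_norm; last first.
  apply: (@le_trans _ _ `|Pmax X n 0 - G 0 ^+ vprod n|) => //.
  by apply: ub_le_sup => //; exists 0.
apply: ge_sup => [|_ [x _ <-]//].
by exists `|Pmax X n 0 - G 0 ^+ vprod n|, 0.
Unshelve. all: by end_near. Qed.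

(* If some coordinate of p is bounded, p is dominated by a vector q that tends
   to infinity but whose volume is a small fraction of the volume of n. *)
Lemma phantom_box_uniform (G : R -> R) (v : natvec d -> R) (c : R) T :
  (forall x, 0 <= G x <= 1) -> Defs.phantom X G -> 0 < c <= 1 ->
  (forall n, vpos n -> G (v n) ^+ vprod n = c) ->
  forall e : R, 0 < e -> \forall n \near vinfty d,
    forall p, (forall i, (p i <= T * (n : natvec d) i)%N) ->
      `|Pmax X p (v n) - G (v n) ^+ vprod p| <= e.
Proof.
move=> G01 /(phantomP G01) pG /andP[c0 c1] Gv e e0.
wlog e1 : e e0 / e < 1 => [wlog|].
  have h0 : 0 < Num.min e 2^-1 by rewrite lt_min e0 invr_gt0 ltr0n.
  have h1 : Num.min e 2^-1 < 1 by rewrite gt_min invf_lt1 ?ltr1n ?orbT.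
  apply: filterS (wlog _ h0 h1) => n Hn p /Hn/le_trans; apply.
  by rewrite ge_min lexx.
wlog T0 : T / (0 < T)%N => [wlog|].
  have := wlog T.+1 isT; apply: filterS => n Hn p pn; apply: Hn => i.
  by apply: (leq_trans (pn i)); rewrite leq_mul2r leqnSn orbT.
have e20 : 0 < e / 2 by lra.
have [N _ HN] := pG _ e20.
(* The box [q] below has its side [i] cut by a factor [K], so that [(G (v n) ^+ vprod q) ^+ K] is at
   least [c ^+ (T ^ d)]; this choice of [K] then forces [G (v n) ^+ vprod q] to be at least
   [1 - e / 2]. *)
have [K K0 HK] : exists2 K, (0 < K)%N & (1 - e / 2) ^+ K < c ^+ (T ^ d).
  have cT : 0 < c ^+ (T ^ d) by exact: exprn_gt0.
  have lt1 : `|1 - e / 2| < 1 by rewrite ltr_norml; lra.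
  have /cvgr_lt/(_ _ cT) [K _ HK] := cvg_expr lt1.
  by exists K.+1 => //; apply: HK => /=.
near=> n => p pn.
have n0 : vpos n by near: n; exact: vinfty_pos.
have [Np|/existsNP[i /negP]] := pselect (vle N p).
  by apply: (le_trans (HN _ Np _)); lra.
rewrite -ltnNge => pNi.
pose Tn : natvec d := [ffun j => (T * n j)%N].
pose q := vset Tn i (n i %/ K).
have KN j : (K * N j <= n j)%N.
  have H : vle [ffun j => (K * N j)%N] n by near: n; exact: vinfty_ge.
  by have := H j; rewrite ffunE.
have Nq : vle N q.
  move=> j; rewrite !ffunE; case: eqP => [->|_].
    by rewrite leq_divRL// mulnC.
  by apply: leq_trans (leq_trans (KN j) _); rewrite leq_pmull.
have pq : vle p q.
  move=> j; rewrite !ffunE; case: eqP => [->|_]//.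
  by apply: (leq_trans (ltnW pNi)); rewrite leq_divRL// mulnC.
have qV : (vprod q * K <= T ^ d * vprod n)%N.
  have -> : (T ^ d * vprod n)%N = vprod Tn.
    rewrite -[X in (T ^ X)%N](card_ord d) -prod_nat_const -big_split.
    by apply: eq_bigr => j _; rewrite ffunE.
  rewrite vprod_vset mulnAC -[in leqRHS](vset_id Tn i) [in leqRHS]vprod_vset.
  rewrite leq_mul2r; apply/orP; right; apply: (leq_trans (leq_trunc_div _ _)).
  by rewrite ffunE leq_pmull.
have /andP[g0 g1] := G01 (v n).
have Gq : 1 - e / 2 <= G (v n) ^+ vprod q.
  rewrite leNgt; apply/negP => Gq.
  have : (G (v n) ^+ vprod q) ^+ K <= (1 - e / 2) ^+ K.
    by rewrite lerXn2r// ?nnegrE ?exprn_ge0 ?(ltW Gq)//; lra.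
  rewrite leNgt; move/negP; apply; apply: (lt_le_trans HK).
  by rewrite -(Gv n n0) -!exprM; apply: ler_wiXn2l => //; rewrite [leqRHS]mulnC.
have GP := HN _ Nq (v n).
have Pp : Pmax X q (v n) <= Pmax X p (v n) by exact: Pmax_le.
have Gp : G (v n) ^+ vprod q <= G (v n) ^+ vprod p.
  by apply: ler_wiXn2l => //; exact: leq_vprod.
have Pp1 := Pmax_le1 X p (v n).
have Gp1 : G (v n) ^+ vprod p <= 1 by exact: exprn_ile1.
by move: GP; rewrite !ler_norml; lra.
Unshelve. all: by end_near. Qed.

(** At levels solving [G (v n) ^+ vprod n = c], all boxes inside [T * psi n] obey the power law of
    [G] up to a uniform error. As the powers of [G] factor exactly, [beta] is at most the sum of the
    errors of the whole box and of its mixed boxes. *)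
Lemma phantom_levels (c : R) : 0 < c < 1 -> has_continuous_phantom X ->
  exists v : natvec d -> R,
    [/\ strongly_monotone v,
        Pmax X n (v n) @[n --> vinfty d] --> c
      & forall (psi : nat -> natvec d) (T : R),
          psi n @[n --> \oo] --> vinfty d -> 0 < T ->
          beta X v psi T n @[n --> \oo] --> (0 : R)].
Proof.
move=> /[dup] c01 /andP[c0 c1] [G [cG pG]].
have G01 x : 0 <= G x <= 1 by rewrite cdf_ge0 cdf_le1.
have /choice[w Gw] : forall k, exists x, G x ^+ k.+1 = c.
  by move=> k; exact: cdf_exp_onto.
(* [w k] serves the volume [k + 1], hence the predecessor. *)
pose v (n : natvec d) := w (vprod n).-1.
have Gv n : vpos n -> G (v n) ^+ vprod n = c.
  by move=> /vprod_gt0 n0; rewrite -[in LHS](prednK n0) Gw.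
exists v; split.
- move=> m n /[dup] m0 /vprod_gt0 m0' n0.
  rewrite leq_eqVlt => /predU1P[mn|mn]; first by rewrite /v mn.
  rewrite leNgt; apply/negP => /ltW/(cumulative_is_nondecreasing G) Gnm.
  have : c < c; last by rewrite ltxx.
  rewrite -{1}(Gv n n0) -(Gv m m0).
  have Gm1 : G (v m) < 1.
    rewrite ltNge; apply/negP => /(exprn_ege1 (vprod m)).
    by rewrite Gv// leNgt c1.
  have Gm0 : 0 < G (v m).
    rewrite lt_neqAle cdf_ge0 andbT; apply/eqP => Gm0.
    by move: (Gv m m0) c0; rewrite -Gm0 expr0n gtn_eqF//= => <-; rewrite ltxx.
  apply: (@le_lt_trans _ _ (G (v m) ^+ vprod n)).
    by rewrite lerXn2r ?nnegrE ?cdf_ge0.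
  by rewrite ltr_iXn2l.
- apply/cvgrPdist_le => e e0; near=> n.
  have n0 : vpos n by near: n; exact: vinfty_pos.
  rewrite -(Gv n n0) distrC.
  suff : forall x, `|Pmax X n x - G x ^+ vprod n| <= e by [].
  by near: n; move: e e0; exact/phantomP.
- move=> psi T psioo T0; apply/cvgrPdist_le => e e0.
  set S := Num.truncn T.
  (* The error is shared between the [k] mixed boxes and the whole box, hence [k.+1]. *)
  pose k := #|{ffun 'I_d -> bool}|.
  have ek : 0 < e / k.+1%:R by rewrite divr_gt0.
  have c01' : 0 < c <= 1 by rewrite c0 ltW.
  near=> n.
  have Hn : forall p, (forall i, (p i <= S.+1 * psi n i)%N) ->
      `|Pmax X p (v (psi n)) - G (v (psi n)) ^+ vprod p| <= e / k.+1%:R.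
    near: n; exact: (psioo _ (phantom_box_uniform S.+1 G01 pG c01' Gv ek)).
  rewrite /beta; set E := (X in sup X).
  have E0 : E (mixing_gap X (v (psi n)) 0 0).
    by exists (0, 0) => //= i; rewrite !ffunE; exact: mulr_ge0 (ltW T0) (ler0n _ _).
  have Eub : has_ubound E by exists 1 => _ [p _ <-]; exact: mixing_gap_le1.
  rewrite sub0r normrN ger0_norm; last first.
    by apply: le_trans (ub_le_sup Eub E0); rewrite normr_ge0.
  apply: ge_sup; first by exists (mixing_gap X (v (psi n)) 0 0).
  move=> _ [[p1 p2] /= pT <-]; set x := v (psi n).
  have pS i : (p1 i + p2 i <= S.+1 * psi n i)%N.
    rewrite -(ler_nat R); apply: (le_trans (pT i)); rewrite natrM.
    by rewrite ler_wpM2r// ltW// truncnS_gt.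
  have mixS (f : {ffun 'I_d -> bool}) i : (mix p1 p2 f i <= S.+1 * psi n i)%N.
    rewrite ffunE; apply: leq_trans (pS i).
    by case: (f i); [exact: leq_addl|exact: leq_addr].
  have dist : `|Pmax X (p1 + p2) x - G x ^+ vprod (p1 + p2)| <= e / k.+1%:R.
    by apply: Hn => i; rewrite ffunE.
  have prod : `|G x ^+ vprod (p1 + p2) - \prod_f Pmax X (mix p1 p2 f) x| <=
      e / k.+1%:R * k%:R.
    rewrite vprodD expr_sum distrC; apply: (le_trans (ler_dist_prod _ _ _)).
    - by move=> f; rewrite Pmax_ge0 Pmax_le1.
    - by move=> f; rewrite exprn_ge0 ?cdf_ge0// exprn_ile1 ?cdf_ge0 ?cdf_le1.
    rewrite mulr_natr -sumr_const; apply: ler_sum => f _.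
    by apply: Hn => i; exact: mixS.
  have -> : e = e / k.+1%:R + e / k.+1%:R * k%:R.
    by rewrite -[X in X + _]mulr1 -mulrDr -natr1 addrC divfK// pnatr_eq0.
  by apply: le_trans (lerD dist prod); exact: ler_distD.
Unshelve. all: by end_near. Qed.

End phantom_to_levels.

(** * Monotone curves and the uniform form of the mixing condition *)

(* A curve through infinitely many points of a set that is not bounded away
   from infinity: the state of the walk is its position and its current target,
   and each step increases one coordinate of the position by one. *)
Section curve_through.
Context (d : nat) (d_gt0 : (0 < d)%N) (g : natvec d -> natvec d).
Hypothesis g_ge : forall N : natvec d, forall i, (N i < g N i)%N.
Implicit Types (c t : natvec d) (s : natvec d * natvec d).

Let target s := if s.1 == s.2 then g s.1 else s.2.

Let next s :=
  (if [pick i | s.1 i < target s i]%N is Some i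
   then vset s.1 i (s.1 i).+1 else s.1, target s).

Let walk n := iter n next (g 0, g 0).

Let psi n := (walk n).1.
Let tgt n := (walk n).2.

Let psi_le_tgt n : vle (psi n) (tgt n).
Proof.
elim: n => [//|n IH] i; rewrite /psi /tgt /= -/(walk n).
have ct : vle (walk n).1 (target (walk n)).
  by rewrite /target; case: ifP => // _ j; exact/ltnW/g_ge.
case: pickP => [j cj|_]; last exact: ct.
by rewrite ffunE; case: eqP => [->|_]//; exact: ct.
Qed.

Let psiS n : exists i, psi n.+1 = vset (psi n) i (psi n i).+1.
Proof.
rewrite {1}/psi /= -/(walk n) -/(psi n).
case: pickP => [i _|H]; first by exists i.
exfalso; move: H; rewrite /target -/(tgt n) -/(psi n).
case: eqP => [_|pt] H.
  by have := H (Ordinal d_gt0); rewrite /= g_ge.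
apply: pt; apply/ffunP => i; apply/eqP; rewrite eqn_leq psi_le_tgt /=.
by rewrite leqNgt H.
Qed.

Let psi_le m n : (m <= n)%N -> vle (psi m) (psi n).
Proof.
move=> /subnK <-; elim: (n - m)%N => [//|k IH] i; rewrite addSn.
apply: leq_trans (IH i) _.
by have [j ->] := psiS (k + m); rewrite ffunE; case: eqP => [->|_].
Qed.

Let tgt_le m n : (m <= n)%N -> vle (tgt m) (tgt n).
Proof.
move=> /subnK <-; elim: (n - m)%N => [//|k IH] i; rewrite addSn.
apply: leq_trans (IH i) _; rewrite /tgt /= -/(walk _) /target.
by case: eqP => [<-|_]//; exact/ltnW/g_ge.
Qed.

Let reach n : exists2 m, (n <= m)%N & psi m = tgt m.
Proof.
(* The sum is the number of unit steps left to the current target; it drops at each step until the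
   target is reached. *)
have [k] := ubnP (\sum_i (tgt n i - psi n i)); elim: k n => // k IH n.
have [ptn _|ptn] := eqVneq (psi n) (tgt n); first by exists n.
have tS : tgt n.+1 = tgt n.
  by rewrite {1}/tgt /= -/(walk n) /target -/(psi n) -/(tgt n) (negPf ptn).
have [i pS] := psiS n.
have ti : (psi n i < tgt n i)%N.
  by have := psi_le_tgt n.+1 i; rewrite pS tS vset_eq.
rewrite ltnS => Hk; case: (IH n.+1) => [|m nm pm]; last first.
  by exists m => //; exact: ltnW.
apply: leq_trans Hk; rewrite tS pS (bigD1 i)// [in leqRHS](bigD1 i)//= vset_eq.
rewrite -addSn subnSK// leq_add2l; apply: leq_sum => j /negPf ji.
by rewrite ffunE ji.
Qed.

Let psi_pos n : vpos (psi n).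
Proof.
by move=> i; apply: leq_trans (psi_le (leq0n n) i); exact: leq_ltn_trans (g_ge _ _).
Qed.

Let psi_unbounded K : exists n, forall i, (K <= psi n i)%N.
Proof.
elim: K => [|K [n Kn]]; first by exists 0%N.
(* Leaving a reached target raises every coordinate of the target by at least one, and the walk
   later reaches a target that dominates the new one. *)
have [m nm pm] := reach n; have [k mk pk] := reach m.+1.
exists k => i; rewrite pk.
apply: leq_trans (tgt_le mk i).
rewrite /tgt /= -/(walk m) /target -/(psi m) -/(tgt m) pm eqxx.
by apply: leq_ltn_trans (g_ge _ _); rewrite -pm (leq_trans (Kn i))//; exact: psi_le.
Qed.

Let psi_cvg : psi n @[n --> \oo] --> vinfty d.
Proof.
move=> A [N _ NA].
have [k Hk] := psi_unbounded (\max_i N i).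
exists k => // n /= kn; apply: NA => i /=.
apply: leq_trans (psi_le kn i); apply: leq_trans (Hk i).
exact: (leq_bigmax i).
Qed.

Lemma curve_through_range (R : realType) : exists psi : nat -> natvec d,
  monotone_curve R psi /\
  forall n, exists2 m, (n <= m)%N & psi m \in [set g N | N in [set: natvec d]].
Proof.
exists psi; split; last first.
  move=> n; have [m nm pm] := reach n; exists m => //; rewrite pm inE {pm}.
  elim: m {nm} => [|m IH]; first by exists 0.
  rewrite /tgt /= -/(walk m) /target.
  by case: eqP => _ //; exists (walk m).1.
split.
- exact: psi_pos.
- exact: psi_cvg.
- by move=> n; exact: psi_le.
- move=> n; have [i ->] := psiS n => /ffunP/(_ i); rewrite vset_eq => /eqP.
  by rewrite ltn_eqF.
(* A step in direction [i] multiplies the volume by [(psi n i + 1) / psi n i], which tends to 1 as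
   all coordinates grow. *)
- apply/cvgrPdist_le => e e0.
  have [K eK] : exists K, K.+1%:R^-1 <= e.
    by exists (Num.truncn e^-1); rewrite invf_ple ?posrE// ltW ?truncnS_gt.
  near=> n.
  have Kn : vle [ffun=> K] (psi n).
    by near: n; exact: (psi_cvg (vinfty_ge [ffun=> K])).
  have [i ->] := psiS n; rewrite vprod_vset -[X in vprod X](vset_id (psi n) i).
  rewrite [X in X%:R / _]vprod_vset; set r := vprod (vset _ _ 1).
  have r0 : r%:R != 0 :> R.
    rewrite pnatr_eq0 -lt0n; apply: vprod_gt0 => j; rewrite ffunE.
    by case: eqP => // _; exact: psi_pos.
  rewrite !natrM -mulf_div divff// mulr1.
  have -> : 1 - (psi n i)%:R / (psi n i).+1%:R = (psi n i).+1%:R^-1 :> R.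
    rewrite -{1}(@divff _ (psi n i).+1%:R) ?pnatr_eq0// -mulrBl.
    by rewrite -natrB// subSnn mul1r.
  rewrite ger0_norm ?invr_ge0//; apply: le_trans eK.
  by rewrite lef_pV2 ?posrE// ler_nat ltnS; have := Kn i; rewrite ffunE.
Unshelve. all: by end_near. Qed.

End curve_through.

(** Otherwise there are points with a gap at least [e] beyond every vector. A monotone curve through
    infinitely many of them has [beta] at least [e] infinitely often. *)
Lemma mixing_uniform (dO : measure_display) (Omega : measurableType dO)
    (R : realType) (P : probability Omega R) (d : nat)
    (X : intvec d -> {RV P >-> R}) (v : natvec d -> R) (T : R) :
  (0 < d)%N -> 0 < T ->
  (forall psi : nat -> natvec d, monotone_curve R psi ->
     beta X v psi T n @[n --> \oo] --> (0 : R)) ->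
  forall e, 0 < e -> \forall n \near vinfty d, forall p1 p2 : natvec d,
    (forall i, (p1 i + p2 i)%:R <= T * ((n : natvec d) i)%:R) ->
    mixing_gap X (v n) p1 p2 < e.
Proof.
move=> d0 T0 Hb e e0; apply: contrapT => bad.
pose B (n : natvec d) := exists2 p : natvec d * natvec d,
  forall i, (p.1 i + p.2 i)%:R <= T * (n i)%:R & e <= mixing_gap X (v n) p.1 p.2.
have /choice[g Hg] : forall N : natvec d, exists n : natvec d,
    (forall i, (N i < n i)%N) /\ B n.
  move=> N; apply: contrapT => noB; apply: bad.
  exists [ffun i => (N i).+1] => // n /= Nn p1 p2 pT.
  rewrite ltNge; apply/negP => gap; apply: noB; exists n; split.
    by move=> i; have := Nn i; rewrite ffunE.
  by exists (p1, p2).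
have [psi [psi_curve psiB]] := curve_through_range d0 (fun N => (Hg N).1) R.
have /cvgrPdist_lt/(_ _ e0) [k _ Hk] := Hb _ psi_curve.
have [m /Hk /=] := psiB k.
rewrite sub0r normrN inE => bm [N _ gN].
have [p pT] := (Hg N).2; rewrite gN => gap.
suff : e < e by rewrite ltxx.
apply: le_lt_trans bm; apply: (le_trans gap); apply: le_trans (ler_norm _).
apply: ub_le_sup; first by exists 1 => _ [q _ <-]; exact: mixing_gap_le1.
by exists p => //=; rewrite -gN.
Qed.

(** * Almost multiplicative sequences *)

Lemma ler_dist_exp (R : realDomainType) (x y : R) n :
  0 <= x <= 1 -> 0 <= y <= 1 -> `|x ^+ n - y ^+ n| <= `|x - y| *+ n.
Proof.
move=> x01 y01; rewrite -[X in x ^+ X](card_ord n) -[X in y ^+ X](card_ord n).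
rewrite -[X in _ *+ X](card_ord n) -!prodr_const -sumr_const.
exact: ler_dist_prod.
Qed.

(** Each splitting costs [eta], and multiplication by [f a <= 1] does not enlarge the error
    accumulated so far. *)
Lemma almost_multiplicative_exp (R : realDomainType) (f : nat -> R) (eta : R) B :
  f 0%N = 1 -> (forall a, 0 <= f a <= 1) ->
  (forall a b, (a + b <= B)%N -> `|f (a + b)%N - f a * f b| <= eta) ->
  forall m a, (m * a <= B)%N -> `|f (m * a)%N - f a ^+ m| <= eta *+ m.
Proof.
move=> f0 f01 fM; elim=> [|m IH] a; first by rewrite mul0n f0 expr0 subrr normr0.
rewrite mulSn => aB; rewrite exprS.
have -> : f (a + m * a)%N - f a * f a ^+ m =
    (f (a + m * a)%N - f a * f (m * a)%N) + f a * (f (m * a)%N - f a ^+ m).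
  by rewrite mulrBr; lra.
apply: (le_trans (ler_normD _ _)); rewrite mulrS lerD ?fM// normrM.
have /andP[fa0 fa1] := f01 a; rewrite ger0_norm//.
apply: (le_trans (ler_piMl _ fa1)) => //; apply: IH.
by apply: leq_trans aB; exact: leq_addl.
Qed.

(* Writing j for the integer part of k a / L, the power f(a)^k is close to
   f(k a), which lies between f((j+1) L) and f(j L), i.e. close to c^(j+1) and
   c^j; taking k-th roots divides the error in the exponent by k. *)
Lemma almost_geometric (R : realType) (c : R) (T k : nat) :
  0 < c < 1 -> (0 < k)%N ->
  exists2 eta : R, 0 < eta & forall (f : nat -> R) (L : nat), (0 < L)%N ->
    f 0%N = 1 -> (forall a, 0 <= f a <= 1) ->
    (forall a b, (a <= b)%N -> f b <= f a) ->
    (forall a b, (a + b <= (k * T).+1 * L)%N ->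
       `|f (a + b)%N - f a * f b| <= eta) ->
    `|f L - c| <= eta ->
    forall a, (a <= T * L)%N ->
      0 < f a /\ `|ln (f a) - a%:R / L%:R * ln c| <= 2 * - ln c / k%:R.
Proof.
move=> /andP[c0 c1] k0; pose N := (k * T).+1; pose D := (k + N + N)%N.
have D0 : 0 < D%:R :> R by rewrite ltr0n !addn_gt0 k0.
(* For m <= N, consecutive powers c^m and c^(m+1) differ by at least [h]. With [eta = h / D] all
   errors together, [k] from the power of [f a] and 2 N from comparing f(m L) with c^m, amount to
   [h] and shift the exponent by at most one. *)
pose h := c ^+ N * (1 - c).
have h0 : 0 < h by rewrite mulr_gt0 ?exprn_gt0// subr_gt0.
exists (h / D%:R); first exact: divr_gt0.
set eta := h / D%:R => f L L0 f0 f01 f_ni fM fL a aT.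
have eta0 : 0 <= eta by rewrite ltW// divr_gt0.
have eta_mono m n : (m <= n)%N -> eta *+ m <= eta *+ n.
  by move=> mn; rewrite -[leLHS]mulr_natr -[leRHS]mulr_natr ler_wpM2l ?ler_nat.
have c01 : 0 <= c <= 1 by rewrite !ltW.
have fpow m b : (m * b <= N * L)%N -> `|f (m * b)%N - f b ^+ m| <= eta *+ m.
  exact: almost_multiplicative_exp.
have fgeo m : (m <= N)%N -> `|f (m * L)%N - c ^+ m| <= eta *+ (N + N).
  move=> mN; rewrite mulrnDr.
  have -> : f (m * L)%N - c ^+ m = (f (m * L)%N - f L ^+ m) + (f L ^+ m - c ^+ m).
    by lra.
  apply: (le_trans (ler_normD _ _)); apply: lerD.
    apply: le_trans (fpow m L _) _; first by rewrite leq_mul2r mN orbT.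
    exact: eta_mono.
  apply: (le_trans (ler_dist_exp _ (f01 L) c01)).
  by apply: le_trans (eta_mono _ _ mN); rewrite lerMn2r fL orbT.
pose j := (k * a %/ L)%N.
have kaT : (k * a <= k * T * L)%N by rewrite -mulnA leq_mul2l aT orbT.
have jL : (j * L <= k * a)%N := leq_trunc_div _ _.
have jSL : (k * a < j.+1 * L)%N by rewrite -ltn_divLR.
have jN : (j < N)%N by rewrite ltnS -[leqRHS](mulnK _ L0) leq_div2r.
have etaD : eta *+ k + eta *+ (N + N) = h.
  by rewrite -mulrnDr addnA -mulr_natr divfK// gt_eqF.
have hc m : (m <= N)%N -> h <= c ^+ m * (1 - c).
  move=> mN; apply: ler_wpM2r; first by rewrite subr_ge0 ltW.
  by apply: ler_wiXn2l => //; exact: ltW.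
have fka : `|f (k * a)%N - f a ^+ k| <= eta *+ k.
  by apply: fpow; apply: (leq_trans kaT); rewrite leq_mul2r leqnSn orbT.
have fak_ge : c ^+ j.+2 <= f a ^+ k.
  have := f_ni _ _ (ltnW jSL); have := fgeo _ jN; have := hc _ jN.
  rewrite (exprSr c j.+1); move: (c ^+ j.+1) (f a ^+ k) etaD fka => u w.
  move: (eta *+ k) (eta *+ (N + N)) => E1 E2; rewrite !ler_norml; lra.
have fak_le : c * f a ^+ k <= c ^+ j.
  have := f_ni _ _ jL; have := fgeo _ (ltnW jN); have := hc _ (ltnW jN).
  have cj : 0 <= c ^+ j by rewrite exprn_ge0 ?ltW.
  move=> h1 h2 h3; have : f a ^+ k <= c ^+ j * (2 - c).
    move: (c ^+ j) (f a ^+ k) etaD fka h1 h2 h3 {cj} => u w.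
    by move: (eta *+ k) (eta *+ (N + N)) => E1 E2; rewrite !ler_norml; lra.
  (* Here c (2 - c) = 1 - (1 - c)^2 <= 1. *)
  move=> /(ler_wpM2l (ltW c0))/le_trans; apply.
  rewrite mulrCA -[leRHS]mulr1 ler_wpM2l//.
  by have := sqr_ge0 (1 - c); rewrite expr2; lra.
have fa0 : 0 < f a.
  have /andP[fa0 _] := f01 a; rewrite lt_neqAle fa0 andbT; apply/eqP => fa00.
  by move: fak_ge; rewrite -fa00 expr0n gtn_eqF//= leNgt exprn_gt0.
split=> //.
have lnc : ln c < 0 by rewrite ln_lt0// c0.
have ln_ge : ln c * j.+2%:R <= ln (f a) * k%:R.
  by rewrite !mulr_natr -!lnXn// ler_ln ?posrE ?exprn_gt0.
have ln_le : ln c + ln (f a) * k%:R <= ln c * j%:R.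
  rewrite !mulr_natr -!lnXn// -lnM ?posrE ?exprn_gt0//.
  by rewrite ler_ln ?posrE ?mulr_gt0 ?exprn_gt0.
have kR : 0 < k%:R :> R by rewrite ltr0n.
have LR : 0 < L%:R :> R by rewrite ltr0n.
(* The exponent [s] lies between j and j + 1, while [ln (f a) * k] lies between (j + 2) ln c and (j
   - 1) ln c. This gives the constant 2. *)
pose s : R := a%:R / L%:R * k%:R.
have js : j%:R <= s <= j%:R + 1.
  rewrite natr1 /s mulrAC ler_pdivlMr// ler_pdivrMr//.
  by rewrite -!natrM !ler_nat ![(a * k)%N]mulnC jL ltnW.
have sl1 : s * ln c <= j%:R * ln c by rewrite ler_wnM2r ?(ltW lnc)//; lra.
have sl2 : (j%:R + 1) * ln c <= s * ln c by rewrite ler_wnM2r ?(ltW lnc)//; lra.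
rewrite ler_pdivlMr// -[X in _ * X <= _](gtr0_norm kR) -normrM mulrBl.
rewrite mulrAC -/s; move: ln_ge; rewrite -natr1 -natr1 ler_norml.
move: (j%:R : R) (ln (f a)) (ln c) ln_le sl1 sl2 => J y l.
by move: (k%:R : R) => K; lra.
Qed.

(** * Continuous distribution functions by inversion *)

(* The generalized inverse of a strictly increasing function is continuous,
   whether or not the function itself is. *)
Lemma continuous_inverse_cdf (R : realType) (A : R -> R) (b : R) :
  (forall g, 0 < g < 1 -> b <= A g) ->
  (forall g h, 0 < g -> g < h -> h < 1 -> A g < A h) ->
  exists G : cumulativeBounded (0 : R) (1 : R), continuous G /\
    forall g x, 0 < g < 1 -> (A g <= x -> g <= G x) /\ (x < A g -> G x <= g).
Proof.
move=> bA A_inc.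
(* The element 0 makes [S x] nonempty and gives [G] the value 0 below [b]. *)
pose S x := [set g | g = 0 \/ 0 < g < 1 /\ A g <= x].
pose G x := sup (S x).
have S0 x : S x !=set0 by exists 0; left.
have Sub x : has_ubound (S x).
  by exists 1 => g [->|[/andP[_ /ltW]]].
have GA g x : 0 < g < 1 -> A g <= x -> g <= G x.
  by move=> g01 Agx; apply: ub_le_sup => //; right.
have AG g x : 0 < g < 1 -> x < A g -> G x <= g.
  move=> /andP[g0 g1] xAg; apply: ge_sup => // h [->|[/andP[h0 h1] Ahx]].
    exact: ltW.
  rewrite leNgt; apply/negP => gh.
  by have := lt_trans (le_lt_trans Ahx xAg) (A_inc _ _ g0 gh h1); rewrite ltxx.
have G0 x : 0 <= G x by apply: ub_le_sup => //; left.
have G1 x : G x <= 1 by apply: ge_sup => // g [->|[/andP[_ /ltW]]].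
have G_nd : {homo G : x y / x <= y}.
  move=> x y xy; apply: ge_sup => // g [->//|[g01 Agx]].
  by apply: GA => //; exact: le_trans xy.
have G_cont : continuous G.
  move=> x; apply/cvgrPdist_le => e e0.
  have up : \forall y \near x, G y <= G x + e.
    have [Ge|Ge] := leP 1 (G x + e).
      by near=> y; exact: le_trans (G1 y) _.
    have g01 : 0 < G x + e < 1 by have := G0 x; rewrite Ge andbT; lra.
    have g01' : 0 < G x + e / 2 < 1 by have := G0 x; lra.
    have xA : x < A (G x + e / 2).
      by rewrite ltNge; apply/negP => /(GA _ _ g01'); lra.
    near=> y; apply: (@le_trans _ _ (G x + e / 2)); last by lra.
    by apply: AG => //; near: y; exact: lt_nbhsl.
  have down : \forall y \near x, G x - e <= G y.
    have [Ge|Ge] := leP (G x - e) 0.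
      by near=> y; exact: le_trans _ (G0 y).
    have g01 : 0 < G x - e / 2 < 1 by have := G1 x; lra.
    have : G x - e / 2 < sup (S x) by rewrite -/(G x); lra.
    move=> /(sup_gt (S0 x)) [h [-> |[/andP[h0 h1] Ahx] gh]]; first by lra.
    (* As [A] increases strictly, this inequality is strict and persists for [y] near [x]; a plateau
       of [A] would make [G] jump. *)
    have Ax : A (G x - e / 2) < x.
      by apply: lt_le_trans Ahx; apply: A_inc => //; case/andP: g01.
    near=> y; apply: (@le_trans _ _ (G x - e / 2)); first by lra.
    by apply: GA => //; apply/ltW; near: y; exact: lt_nbhsr.
  near=> y; rewrite ler_norml.
  have : G y <= G x + e by near: y.
  have : G x - e <= G y by near: y.
  by lra.
have G_rc : right_continuous G.
  by move=> x; apply: cvg_at_right_filter; exact: G_cont.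
have GNy : G @ -oo --> (0 : R).
  apply/cvgrPdist_le => e e0; near=> x.
  rewrite sub0r normrN ger0_norm//; apply: (ge_sup (S0 x)) => g [->|[g01 Agx]].
    exact: ltW.
  have xb : x < b by near: x; apply: nbhs_ninfty_lt; exact: num_real.
  by have := le_lt_trans (le_trans (bA _ g01) Agx) xb; rewrite ltxx.
have Gy : G @ +oo --> (1 : R).
  apply/cvgrPdist_le => e e0; near=> x.
  rewrite ger0_norm ?subr_ge0// lerBlDr -lerBlDl.
  pose g := Num.max (1 - e) 2^-1.
  have g01 : 0 < g < 1.
    by rewrite lt_max gt_max invr_gt0 ltr0n orbT invf_lt1// ltr1n andbT; lra.
  apply: (@le_trans _ _ g); first by rewrite le_max lexx.
  by apply: GA => //; near: x; apply: nbhs_pinfty_ge; exact: num_real.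
pose Gc : cumulativeBounded (0 : R) (1 : R) := HB.pack G
  (isCumulative.Build R _ R G G_nd G_rc)
  (isCumulativeBounded.Build R 0 1 G GNy Gy).
by exists Gc; split=> // g x g01; split; [exact: GA|exact: AG].
Unshelve. all: by end_near. Qed.

(** * From levels to a continuous phantom distribution function *)

Section levels_to_phantom.
Context (dO : measure_display) (Omega : measurableType dO) (R : realType).
Context (P : probability Omega R) (d : nat) (i0 : 'I_d).
Context (X : intvec d -> {RV P >-> R}).
Implicit Types (m n p q : natvec d).

Lemma vset_trunc_cvg (t : R) : 0 < t ->
  vset n i0 (Num.truncn (t * (n i0)%:R)) @[n --> vinfty d] --> vinfty d.
Proof.
move=> t0 A [N _ NA]; have [K HK] : exists K, (N i0)%:R / t <= K%:R.
  by exists (Num.truncn ((N i0)%:R / t)).+1; rewrite ltW// truncnS_gt.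
suff : \forall n \near vinfty d, A (vset n i0 (Num.truncn (t * (n i0)%:R))) by [].
near=> n; apply: NA => j; rewrite ffunE; case: eqP => [->|_].
  have Kn : (K <= n i0)%N by near: n; exact: vinfty_coord.
  rewrite truncn_ge_nat ?(mulr_ge0 (ltW t0))// mulrC -ler_pdivrMr//.
  by apply: (le_trans HK); rewrite ler_nat.
by move: j; near: n; exact: vinfty_ge.
Unshelve. all: by end_near. Qed.

Context (v : natvec d -> R) (c : R).
Hypothesis c01 : 0 < c < 1.
Hypothesis v_mono : strongly_monotone v.
Hypothesis v_cvg : Pmax X n (v n) @[n --> vinfty d] --> c.
Hypothesis v_mixing : forall (T : R) e, 0 < T -> 0 < e ->
  \forall n \near vinfty d, forall p1 p2 : natvec d,
    (forall i, (p1 i + p2 i)%:R <= T * ((n : natvec d) i)%:R) ->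
    mixing_gap X (v n) p1 p2 < e.

(** For large [q], [almost_geometric] applies to the probability as a function of the side [a], with
    [L = q i0]: mixing gives the product rule, and condition (i) the value near [c] at [L]. *)
Lemma Pmax_vset_geometric T (e : R) : 0 < e -> \forall q \near vinfty d,
  forall a, (a <= T * (q : natvec d) i0)%N ->
    0 < Pmax X (vset q i0 a) (v q) /\
    `|ln (Pmax X (vset q i0 a) (v q)) - a%:R / (q i0)%:R * ln c| <= e.
Proof.
move=> e0; have [k k0 ke] : exists2 k, (0 < k)%N & 2 * - ln c / k%:R <= e.
  exists (Num.truncn (2 * - ln c / e)).+1 => //.
  by rewrite ler_pdivrMr// [leRHS]mulrC -ler_pdivrMr// ltW// truncnS_gt.
have [eta eta0 Heta] := almost_geometric T c01 k0.
near=> q => a aT.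
have L0 : (0 < q i0)%N by near: q; exact: vinfty_coord.
have [|||||f0 fe] :=
  Heta (fun b => Pmax X (vset q i0 b) (v q)) (q i0) L0 _ _ _ _ _ a aT.
- by rewrite (@Pmax_eq1 _ _ _ _ _ _ _ i0)// vset_eq.
- by move=> b; rewrite Pmax_ge0 Pmax_le1.
- by move=> b b' bb'; apply: Pmax_le => //; exact: vle_vset.
- move=> b b' bb'; rewrite -mixing_gap_vset; apply: ltW.
  have gap : forall p1 p2 : natvec d,
    (forall i, (p1 i + p2 i)%:R <= (k * T).+1%:R * (q i)%:R :> R) ->
    mixing_gap X (v q) p1 p2 < eta by near: q; exact: v_mixing.
  apply: gap => j; rewrite -natrM ler_nat !ffunE; case: eqP => [->//|_].
  by rewrite addn0 leq_pmull.
- rewrite vset_id distrC; near: q; exact: (cvgr_dist_le _ _ v_cvg).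
- by split=> //; exact: le_trans ke.
Unshelve. all: by end_near. Qed.

Let lnc : ln c < 0. Proof. exact: ln_lt0. Qed.

(* With t = ln c / ln h, the box n is about 1 / t times as long in the direction
   i0 as the box whose level is used, and c^(1/t) = h. *)
Lemma Pmax_vset_cvg (h : R) : 0 < h < 1 ->
  Pmax X n (v (vset n i0 (Num.truncn (ln c / ln h * (n i0)%:R))))
    @[n --> vinfty d] --> h.
Proof.
move=> h01; have lnh : ln h < 0 by exact: ln_lt0.
have h0 : 0 < h by case/andP: h01.
set t := ln c / ln h; have t0 : 0 < t by rewrite /t nmulr_rgt0// invr_lt0.
pose a (n : natvec d) := Num.truncn (t * (n i0)%:R).
have a_le n : (a n)%:R <= t * (n i0)%:R by rewrite truncn_le// mulr_ge0// ltW.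
have a_gt n : t * (n i0)%:R < (a n)%:R + 1 by rewrite natr1 truncnS_gt.
(* The factor 2 absorbs the rounding in [a n], so that [n i0 <= T * a n] for large [n]. *)
have [T HT] : exists T : nat, 2 / t <= T%:R.
  by exists (Num.truncn (2 / t)).+1; rewrite ltW// truncnS_gt.
have geo e : 0 < e -> \forall n \near vinfty d,
    0 < Pmax X n (v (vset n i0 (a n))) /\
    `|ln (Pmax X n (v (vset n i0 (a n)))) - (n i0)%:R / (a n)%:R * ln c| <= e.
  move=> e0; near=> n.
  have nT : (n i0 <= T * a n)%N.
    have Tn : (T <= n i0)%N by near: n; exact: vinfty_coord.
    rewrite -(ler_nat R) natrM; have := a_gt n; move: Tn; rewrite -(ler_nat R).
    move: HT; rewrite ler_pdivrMr// => HT Tn ta.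
    have := ler_wpM2l (ler0n R T) (ltW ta).
    have := ler_wpM2r (ler0n R (n i0)) HT.
    move: (T%:R : R) ((n i0)%:R : R) ((a n)%:R : R) Tn => T' N A Tn h1 h2.
    by lra.
  have : forall b, (b <= T * vset n i0 (a n) i0)%N ->
      0 < Pmax X (vset (vset n i0 (a n)) i0 b) (v (vset n i0 (a n))) /\
      `|ln (Pmax X (vset (vset n i0 (a n)) i0 b) (v (vset n i0 (a n)))) -
        b%:R / (vset n i0 (a n) i0)%:R * ln c| <= e.
    by near: n; exact: (vset_trunc_cvg t0 (Pmax_vset_geometric T e0)).
  by move=> /(_ (n i0)); rewrite vset_vset vset_id vset_eq; apply.
suff ln_cvg : ln (Pmax X n (v (vset n i0 (a n)))) @[n --> vinfty d] --> ln h.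
  have -> : h = expR (ln h) by rewrite lnK.
  apply: cvg_trans (continuous_cvg _ (@continuous_expR R (ln h)) ln_cvg).
  apply: near_eq_cvg; have := geo _ ltr01; apply: filterS => n [Pn _].
  by rewrite /= lnK.
apply/cvgrPdist_le => e e0.
have e20 : 0 < e / 2 by lra.
have [K HK] : exists K : nat, 2 * - ln h / e <= K%:R.
  by exists (Num.truncn (2 * - ln h / e)).+1; rewrite ltW// truncnS_gt.
near=> n.
have [_ Hn] : 0 < Pmax X n (v (vset n i0 (a n))) /\
    `|ln (Pmax X n (v (vset n i0 (a n)))) - (n i0)%:R / (a n)%:R * ln c| <= e / 2.
  by near: n; exact: geo.
have Ka : (K.+1 <= a n)%N.
  have : (K.+1 <= vset n i0 (a n) i0)%N.
    by near: n; exact: (vset_trunc_cvg t0 (vinfty_coord i0 K.+1)).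
  by rewrite vset_eq.
have a0 : 0 < (a n)%:R :> R by rewrite ltr0n (leq_trans _ Ka).
have cE : ln c = t * ln h by rewrite divfK// lt_eqF.
(* The rounding error of [a n] is below 1, so the difference is at most [- ln h / a n]. *)
have dist : `|ln h - (n i0)%:R / (a n)%:R * ln c| <= e / 2.
  have -> : ln h - (n i0)%:R / (a n)%:R * ln c =
      - ln h * ((t * (n i0)%:R - (a n)%:R) / (a n)%:R).
    by rewrite cE [in RHS]mulrBl divff ?gt_eqF//; lra.
  have := a_le n; have := a_gt n => ta_lt ta_ge.
  rewrite normrM normrN (ltr0_norm lnh) ger0_norm; last first.
    by apply: divr_ge0; rewrite ?subr_ge0// ltW.
  rewrite mulrA ler_pdivrMr//; apply: (@le_trans _ _ (- ln h)).
    by rewrite ler_piMr//; lra.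
  have aK : K%:R <= (a n)%:R :> R by rewrite ler_nat ltnW.
  have := ler_wpM2r (ltW e0) aK; move: HK; rewrite ler_pdivrMr//; lra.
have -> : ln h - ln (Pmax X n (v (vset n i0 (a n)))) =
  (ln h - (n i0)%:R / (a n)%:R * ln c) -
  (ln (Pmax X n (v (vset n i0 (a n)))) - (n i0)%:R / (a n)%:R * ln c) by lra.
apply: (le_trans (ler_normB _ _)); lra.
Unshelve. all: by end_near. Qed.

(** The levels as a sequence: [u k] is the level of volume [k + 1], read off a box whose other sides
    are 1. *)
Let u k := v (vset [ffun=> 1%N] i0 k.+1).

Let vprod_vset1 k : vprod (vset [ffun=> 1%N] i0 k.+1) = k.+1.
Proof.
rewrite vprod_vset [X in (_ * X)%N]big1 ?muln1// => j _.
by rewrite !ffunE if_same.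
Qed.

Let vpos_vset1 k : vpos (vset [ffun=> 1%N] i0 k.+1).
Proof. by move=> j; rewrite !ffunE; case: eqP. Qed.

Let u_mono k l : (k <= l)%N -> u k <= u l.
Proof. by move=> kl; apply: v_mono; rewrite ?vprod_vset1//; exact: vpos_vset1. Qed.

(** Strong monotonicity, applied in both directions, identifies the levels of boxes of equal
    volume. *)
Let v_u q : vpos q -> v q = u (vprod q).-1.
Proof.
move=> q0; have qS := prednK (vprod_gt0 q0).
by apply/le_anti; rewrite !v_mono//= vprod_vset1 qS.
Qed.

Let ratio (h : R) := ln c / ln h.

(** For large [n], [u (idx h n)] is the level of the box obtained from [n] by rescaling side [i0] by
    [ratio h]; the predecessor undoes the shift in [u]. *)
Let idx (h : R) n := (vprod (vset n i0 (Num.truncn (ratio h * (n i0)%:R)))).-1.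

Let ratio_gt0 h : 0 < h < 1 -> 0 < ratio h.
Proof. by move=> /ln_lt0 lnh; rewrite nmulr_rgt0// invr_lt0. Qed.

Let ratio_lt h h1 : 0 < h -> h < h1 -> h1 < 1 -> ratio h < ratio h1.
Proof.
move=> h0 hh1 h11; have h10 := lt_trans h0 hh1.
have l1 : ln h1 < 0 by rewrite ln_lt0// h10.
have l : ln h < ln h1 by rewrite ltr_ln.
by rewrite ltr_nM2l// ltf_nV2 ?negrE// (lt_trans l).
Qed.

Let u_idx_cvg h : 0 < h < 1 -> Pmax X n (u (idx h n)) @[n --> vinfty d] --> h.
Proof.
move=> h01; apply: cvg_trans (Pmax_vset_cvg h01); apply: near_eq_cvg.
near=> n; rewrite /= v_u//.
by near: n; exact: (vset_trunc_cvg (ratio_gt0 h01) (vinfty_pos d)).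
Unshelve. all: by end_near. Qed.

(** [idx] rounds one side, whereas the middle term rounds the volume. For large [n], passing from
    [h] to [h1] lengthens the unrounded side by at least 2, which outweighs the roundings. *)
Let idx_le h h1 : 0 < h -> h < h1 -> h1 < 1 -> \forall n \near vinfty d,
  (idx h n <= Num.truncn (ratio h * (vprod n)%:R) <= idx h1 n)%N.
Proof.
move=> h0 hh1 h11; have h10 := lt_trans h0 hh1.
have r0 : 0 < ratio h by rewrite ratio_gt0// h0 (lt_trans hh1).
have r10 : 0 < ratio h1 by rewrite ratio_gt0// h10.
have dr : 0 < ratio h1 - ratio h by rewrite subr_gt0 ratio_lt.
have [K HK] : exists K : nat, 2 / (ratio h1 - ratio h) <= K%:R.
  by exists (Num.truncn (2 / (ratio h1 - ratio h))).+1; rewrite ltW// truncnS_gt.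
near=> n.
have n0 : vpos n by near: n; exact: vinfty_pos.
have Kn : (K <= n i0)%N by near: n; exact: vinfty_coord.
have nE : vprod n = (n i0 * vprod (vset n i0 1))%N.
  by rewrite -[in LHS](vset_id n i0) vprod_vset.
rewrite /idx [in X in (X <= _ <= _)%N]vprod_vset [in X in (_ <= _ <= X)%N]vprod_vset.
rewrite nE natrM mulrA.
set r := vprod (vset n i0 1); set L : R := (n i0)%:R.
have r_gt0 : (0 < r)%N.
  by apply: vprod_gt0 => j; rewrite ffunE; case: eqP => // _; exact: n0.
have L0 : 0 <= L by rewrite ler0n.
have rL0 : 0 <= ratio h * L by rewrite mulr_ge0// ltW.
apply/andP; split.
  apply: leq_trans (leq_pred _) _.
  rewrite truncn_ge_nat ?(mulr_ge0 rL0)// natrM ler_wpM2r//.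
  by rewrite truncn_le.
have hKL : 2 <= (ratio h1 - ratio h) * L.
  move: HK; rewrite ler_pdivrMr// mulrC => /le_trans; apply.
  by apply: ler_wpM2l; [exact: ltW|rewrite ler_nat].
set a1 := Num.truncn (ratio h1 * L).
have ha1 : ratio h1 * L < a1%:R + 1 by rewrite natr1 truncnS_gt.
have ha : ratio h * L + 1 < a1%:R by move: hKL; rewrite mulrBl; lra.
have a1_gt0 : (0 < a1)%N by rewrite -(ltr_nat R); lra.
rewrite -ltnS prednK ?muln_gt0 ?a1_gt0// -(ltr_nat R) natrM.
apply: (@le_lt_trans _ _ (ratio h * L * r%:R)).
  by rewrite truncn_le// mulr_ge0.
by rewrite ltr_pM2r ?ltr0n//; lra.
Unshelve. all: by end_near. Qed.

(** The probabilities at the two levels tend to [h < h1], so monotonicity in the level rules out the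
    reverse order. *)
Let u_idx_lt h h1 : 0 < h -> h < h1 -> h1 < 1 -> \forall n \near vinfty d,
  u (idx h n) < u (idx h1 n).
Proof.
move=> h0 hh1 h11; pose m := (h + h1) / 2.
have hm : h < m by rewrite /m; lra.
have mh : m < h1 by rewrite /m; lra.
have h01 : 0 < h < 1 by lra.
have h101 : 0 < h1 < 1 by lra.
near=> n; rewrite ltNge; apply/negP => /(Pmax_le X (fun i => leqnn (n i))).
have : Pmax X n (u (idx h n)) < m by near: n; exact: (cvgr_lt _ (u_idx_cvg h01)).
have : m < Pmax X n (u (idx h1 n)) by near: n; exact: (cvgr_gt _ (u_idx_cvg h101)).
by lra.
Unshelve. all: by end_near. Qed.

(** Levels for the limits 1/4 and 1/2 are eventually strictly ordered, and the first index is
    eventually at least [k]. Thus [u] has no largest value, although it may be bounded. *)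
Let u_unbounded k : exists l, u k < u l.
Proof.
have h0 : (0 : R) < 4^-1 by lra.
have h1 : (4^-1 : R) < 2^-1 by lra.
have h2 : (2^-1 : R) < 1 by lra.
have /filter_ex[n [ult [kn nv]]] : \forall n \near vinfty d,
    u (idx 4^-1 n) < u (idx 2^-1 n) /\
    ((k < vset n i0 (Num.truncn (ratio 4^-1 * (n i0)%:R)) i0)%N /\
     vpos (vset n i0 (Num.truncn (ratio 4^-1 * (n i0)%:R)))).
  have r0 : 0 < ratio 4^-1 by rewrite ratio_gt0//; lra.
  near=> n; split; [|split]; near: n; first exact: u_idx_lt.
  - exact: (vset_trunc_cvg r0 (vinfty_coord i0 k.+1)).
  - exact: (vset_trunc_cvg r0 (vinfty_pos d)).
exists (idx 2^-1 n); apply: le_lt_trans ult; apply: u_mono.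
rewrite /idx -ltnS prednK ?vprod_gt0//.
by apply: (leq_trans kn); exact: leq_coord_vprod.
Unshelve. all: by end_near. Qed.

(** [u (nx k)] is the next value of [u] above [u k]; repeated values are skipped. *)
Let nx k := ex_minn (u_unbounded k).

Let u_nx k : u k < u (nx k).
Proof. by rewrite /nx; case: ex_minnP. Qed.

Let u_nx_le k l : u k < u l -> u (nx k) <= u l.
Proof. by rewrite /nx; case: ex_minnP => m _ + /[dup] => H /H/u_mono. Qed.

(* The second summand makes A strictly increasing on the intervals on which the
   first one is constant, without reaching the next value of u. *)
Let A (g : R) := let k := Num.truncn (ratio g) in u k + g * (u (nx k) - u k).

Let A_ge g : 0 < g < 1 -> u (Num.truncn (ratio g)) <= A g.
Proof.
move=> /andP[g0 g1]; rewrite lerDl mulr_ge0 ?(ltW g0)// subr_ge0.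
exact/ltW/u_nx.
Qed.

Let A_lt g : 0 < g < 1 -> A g < u (nx (Num.truncn (ratio g))).
Proof.
move=> /andP[g0 g1]; rewrite /A; set k := Num.truncn _.
by rewrite -ltrBrDl gtr_pMl ?subr_gt0 ?u_nx.
Qed.

(** If both truncated ratios give the same value of [u], the second summand decides; otherwise a
    value of [u] separates [A g] from [A h]. *)
Let A_inc g h : 0 < g -> g < h -> h < 1 -> A g < A h.
Proof.
move=> g0 gh h1; have g01 : 0 < g < 1 by rewrite g0 (lt_trans gh).
have h01 : 0 < h < 1 by rewrite h1 (lt_trans g0).
set k := Num.truncn (ratio g); set l := Num.truncn (ratio h).
have kl : (k <= l)%N by rewrite le_truncn// ltW// ratio_lt.
have := u_mono kl; rewrite le_eqVlt => /orP[/eqP ukl|ukl].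
  rewrite /A -/k -/l ukl ltrD2l.
  apply: (@le_lt_trans _ _ (g * (u (nx l) - u l))).
    apply: ler_wpM2l; first exact: ltW.
    by rewrite lerB// u_nx_le// ukl u_nx.
  by rewrite ltr_pM2r// subr_gt0 u_nx.
apply: lt_le_trans (A_lt g01) _; apply: le_trans (A_ge h01).
exact: u_nx_le.
Qed.

(** The value that [G x] must take for [G x ^+ vprod n] to be [h]. *)
Let root n (h : R) := h `^ (vprod n)%:R^-1.

Let root_bnd n h : vpos n -> 0 < h < 1 -> 0 < root n h < 1.
Proof.
move=> /vprod_gt0 n0 /andP[h0 h1]; rewrite powR_gt0//= ltNge; apply/negP.
move=> /(exprn_ege1 (vprod n)).
rewrite -powR_mulrn ?powR_ge0// -powRrM mulVf ?pnatr_eq0 -?lt0n//.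
by rewrite powRr1 ?(ltW h0)// leNgt h1.
Qed.

Let root_exp n h : vpos n -> 0 <= h -> root n h ^+ vprod n = h.
Proof.
move=> /vprod_gt0 n0 h0.
by rewrite -powR_mulrn ?powR_ge0// -powRrM mulVf ?pnatr_eq0 -?lt0n// powRr1.
Qed.

(** Since [ratio (root n h) = ratio h * vprod n], the level [A (root n h)] is caught between
    [u (idx h n)] and [u (idx h2 n)], with [h2] slightly above [h]; the limits of the probabilities
    there are known. *)
Let A_root_cvg h : 0 < h < 1 -> Pmax X n (A (root n h)) @[n --> vinfty d] --> h.
Proof.
move=> /[dup] h01 /andP[h0 h1]; apply/cvgrPdist_le => e e0.
pose s := Num.min e (1 - h).
have s0 : 0 < s by rewrite lt_min e0 subr_gt0.
have se : s <= e by rewrite ge_min lexx.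
have sh : s <= 1 - h by rewrite ge_min lexx orbT.
(* [h3] absorbs the rounding of the indices, [h2] the passage to the next value of [u]. *)
pose h2 := h + s / 2; pose h3 := h + s / 4.
have hh3 : h < h3 by rewrite /h3; lra.
have h32 : h3 < h2 by rewrite /h2 /h3; lra.
have h21 : h2 < 1 by rewrite /h2; lra.
have h31 : h3 < 1 := lt_trans h32 h21.
have h30 : 0 < h3 := lt_trans h0 hh3.
have h201 : 0 < h2 < 1 by lra.
have e20 : 0 < e / 2 by lra.
near=> n.
have n0 : vpos n by near: n; exact: vinfty_pos.
pose k := Num.truncn (ratio h * (vprod n)%:R).
have kE : Num.truncn (ratio (root n h)) = k.
  by congr Num.truncn; rewrite /ratio ln_powR invfM invrK mulrCA mulrC.
have : (idx h n <= Num.truncn (ratio h * (vprod n)%:R) <= idx h3 n)%N.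
  by near: n; exact: idx_le.
rewrite -/k => /andP[ik ki].
have uu : u (idx h3 n) < u (idx h2 n).
  by near: n; exact: u_idx_lt.
have lo : `|h - Pmax X n (u (idx h n))| <= e / 2.
  by near: n; exact: (cvgr_dist_le _ _ (u_idx_cvg h01)).
have hi : `|h2 - Pmax X n (u (idx h2 n))| <= e / 2.
  by near: n; exact: (cvgr_dist_le _ _ (u_idx_cvg h201)).
have nn : vle n n by move=> i.
have r01 := root_bnd n0 h01.
have lo' : Pmax X n (u (idx h n)) <= Pmax X n (A (root n h)).
  apply: Pmax_le => //; apply: le_trans (A_ge r01); rewrite kE.
  exact: u_mono.
have hi' : Pmax X n (A (root n h)) <= Pmax X n (u (idx h2 n)).
  apply: Pmax_le => //; apply: (le_trans (ltW (A_lt r01))); rewrite kE.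
  by apply: u_nx_le; apply: le_lt_trans uu; exact: u_mono.
by move: lo hi; rewrite /h2 !ler_norml; lra.
Unshelve. all: by end_near. Qed.

(** [G] inverts [A], so the probability is close to [h] where [G x ^+ vprod n] crosses a grid value
    [h]. Monotonicity in [x] extends this from a finite grid to all [x]. *)
Lemma levels_phantom : has_continuous_phantom X.
Proof.
have A_bnd g : 0 < g < 1 -> u 0 <= A g.
  by move=> g01; apply: le_trans (A_ge g01); exact: u_mono.
have [G [G_cont AG]] := continuous_inverse_cdf A_bnd A_inc.
exists G; split=> //; apply/phantomP => [x|e e0]; first by rewrite cdf_ge0 cdf_le1.
(* The comparison below loses up to two grid cells of width 1 / K. *)
have [K K0 Ke] : exists2 K : nat, (0 < K)%N & 2 / K%:R <= e / 2.
  exists (Num.truncn (4 / e)).+1 => //.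
  have := truncnS_gt (4 / e); rewrite ltr_pdivrMr// ler_pdivrMr//.
  by move: ((Num.truncn _).+1%:R : R) => y; lra.
have KR : 0 < K%:R :> R by rewrite ltr0n.
pose h (i : nat) : R := i%:R / K%:R.
have h01 i : (0 < i < K)%N -> 0 < h i < 1.
  by move=> /andP[i0_gt0 iK]; rewrite divr_gt0 ?ltr0n//= ltr_pdivrMr// mul1r ltr_nat.
have e20 : 0 < e / 2 by lra.
have grid : \forall n \near vinfty d, forall i : 'I_K, (0 < i)%N ->
    `|h i - Pmax X n (A (root n (h i)))| <= e / 2.
  apply: filter_forall => i; have [->|i_gt0] := posnP i; first by near=> n.
  have hi01 : 0 < h i < 1 by rewrite h01// i_gt0 ltn_ord.
  by near=> n => _; near: n; exact: (cvgr_dist_le _ _ (A_root_cvg hi01)).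
near=> n => x.
have n0 : vpos n by near: n; exact: vinfty_pos.
have Hg : forall i : 'I_K, (0 < i)%N ->
    `|h i - Pmax X n (A (root n (h i)))| <= e / 2 by near: n.
have nn : vle n n by move=> i.
set H := G x ^+ vprod n.
have H0 : 0 <= H by rewrite exprn_ge0// cdf_ge0.
have H1 : H <= 1 by rewrite exprn_ile1// ?cdf_ge0// cdf_le1.
have F0 := Pmax_ge0 X n x; have F1 := Pmax_le1 X n x.
have lower i : (0 < i < K)%N -> h i < H -> h i - e / 2 <= Pmax X n x.
  move=> iK hiH; have hi01 := h01 _ iK; have r01 := root_bnd n0 hi01.
  have Ax : A (root n (h i)) <= x.
    rewrite leNgt; apply/negP => /(AG _ _ r01).2 Gx.
    have : H <= h i.
      rewrite -[h i](root_exp n0); last by case/andP: hi01 => /ltW.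
      rewrite lerXn2r// nnegrE ?cdf_ge0//; by case/andP: r01 => /ltW.
    by rewrite leNgt hiH.
  case/andP: iK => i_gt0 iK.
  have := Hg (Ordinal iK) i_gt0; rewrite /= ler_norml.
  by have := Pmax_le X nn Ax; lra.
have upper i : (0 < i < K)%N -> H < h i -> Pmax X n x <= h i + e / 2.
  move=> iK hiH; have hi01 := h01 _ iK; have r01 := root_bnd n0 hi01.
  have Ax : x <= A (root n (h i)).
    rewrite leNgt; apply/negP => /ltW/(AG _ _ r01).1 Gx.
    have : h i <= H.
      rewrite -[h i](root_exp n0); last by case/andP: hi01 => /ltW.
      rewrite lerXn2r// nnegrE ?cdf_ge0//; by case/andP: r01 => /ltW.
    by rewrite leNgt hiH.
  case/andP: iK => i_gt0 iK.
  have := Hg (Ordinal iK) i_gt0; rewrite /= ler_norml.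
  by have := Pmax_le X nn Ax; lra.
pose i := Num.truncn (K%:R * H).
have /andP[iH Hi] : i%:R <= K%:R * H < i%:R + 1.
  by rewrite natr1 truncn_itv// mulr_ge0.
have hS j : h j.+1 = h j + K%:R^-1 by rewrite /h -natr1 mulrDl mul1r.
have hiH : h i <= H by rewrite ler_pdivrMr// mulrC.
have Hhi : H < h i.+1 by rewrite ltr_pdivlMr// mulrC -natr1.
have K'0 : 0 < K%:R^-1 :> R by rewrite invr_gt0.
rewrite ler_norml; apply/andP; split.
  have iK : (i < K.+1)%N.
    rewrite ltnS -(ler_nat R); apply: (le_trans iH).
    by rewrite ler_piMr// ltW.
  (* [lower] needs a positive grid index whose value is strictly below [H], hence i - 1. If i <= 1,
     then [H < 2 / K] and the bound is trivial. *)
  case: (ltnP 1 i) => [i1|i1].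
    have [i' iE] : exists i', i = i'.+2 by case: (i) i1 => [|[|i']]// _; exists i'.
    have iK' : (0 < i'.+1 < K)%N by move: iK; rewrite iE ltnS.
    move: hiH Hhi; rewrite hS iE hS => h1 h2.
    by have := lower _ iK'; lra.
  have hi1 : h i <= K%:R^-1.
    by rewrite /h -[leRHS]mul1r ler_wpM2r ?invr_ge0// (ler_nat R i 1).
  by move: Hhi; rewrite hS; lra.
case: (ltnP i.+1 K) => [iK|Ki].
  by have := upper i.+1 iK Hhi; rewrite hS; lra.
have : 1 <= h i.+1 by rewrite ler_pdivlMr// mul1r ler_nat.
by rewrite hS; lra.
Unshelve. all: by end_near. Qed.

End levels_to_phantom.

Theorem theorem1p2 (dO : measure_display) (Omega : measurableType dO)
    (R : realType) (P : probability Omega R)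
    (d : nat) (hd : (0 < d)%N)
    (X : intvec d -> {RV P >-> R}) (hX : stationary X) :
  has_continuous_phantom X <->
  exists (gamma : R) (v : natvec d -> R),
    [/\ 0 < gamma < 1,
        strongly_monotone v,
        Pmax X n (v n) @[n --> vinfty d] --> gamma
      & forall (psi : nat -> natvec d) (T : R),
          monotone_curve R psi -> 0 < T ->
          beta X v psi T n @[n --> \oo] --> (0 : R)].
Proof.
(* Any value in (0, 1) would serve as [gamma]. *)
split=> [/(phantom_levels (c := 2^-1))[|v [v_mono v_cvg v_beta]]|].
- by lra.
- exists 2^-1, v; split=> //; first by lra.
  by move=> psi T [_ psi_cvg _ _ _] T0; exact: v_beta.
case=> [gamma [v [gamma01 v_mono v_cvg v_beta]]].
apply: (levels_phantom (Ordinal hd) gamma01 v_mono v_cvg) => T e T0 e0.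
by apply: mixing_uniform => // psi psi_curve; exact: v_beta.
Qed.
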